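(* Let $E$ be a free $A_n(K)$-module with basis $e_1,\dots,e_m$, let $N$ be an $A_n(K)$-submodule of $E$, and let $G=\{g_1,\dots,g_r\}$ be a Gröbner basis of $N$ with respect to the order $<_\partial$. Suppose that $S_x(g_i,g_j)$ $(x,\partial)$-reduces to $0$ modulo $G$ for any $g_i,g_j\in G$. Then $G$ is an $(x,\partial)$-Gröbner basis of $N$.
   Context: $K$ is a field of characteristic zero and $A_n(K)$ is the Weyl algebra generated over $K$ by $x_1,\dots,x_n,\partial_1,\dots,\partial_n$, all pairs commuting except $\partial_ix_i=x_i\partial_i+1$. $\Theta$ is the set of monomials $x^\alpha\partial^\beta$ ($\alpha,\beta\in\mathbf N^n$), a $K$-basis of $A_n(K)$; $ord_x(x^\alpha\partial^\beta)=|\alpha|$, $ord_\partial(x^\alpha\partial^\beta)=|\beta|$. Terms are the elements $\theta e_i$ ($\theta\in\Theta$), a $K$-basis of $E$; terms appearing in $f$ are those with nonzero coefficient; $ord_x(\theta e_i)=ord_x\theta$, $ord_\partial(\theta e_i)=ord_\partial\theta$. For $\theta=x^\alpha\partial^\beta$ and a term $w=x^\gamma\partial^\delta e_i$, $\theta w:=x^{\alpha+\gamma}\partial^{\beta+\delta}e_i$; $\theta f$ for $f\in E$ is the module action. $x^\alpha\partial^\beta e_j$ divides $x^\gamma\partial^\delta e_i$ if $i=j$, $\alpha\le\gamma$, $\beta\le\delta$ componentwise; the quotient is $x^{\gamma-\alpha}\partial^{\delta-\beta}\in\Theta$. The lcm of two terms with the same index $e_i$ is $x^{\max(\alpha,\gamma)}\partial^{\max(\beta,\delta)}e_i$;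 for different indices it is $0$. Orders: $x^\alpha\partial^\beta<_x x^\gamma\partial^\delta$ iff $(|\alpha|,|\beta|,\alpha,\beta)$ is lexicographically smaller than $(|\gamma|,|\delta|,\gamma,\delta)$; $<_\partial$ likewise using $(|\beta|,|\alpha|,\beta,\alpha)$; extended to terms by $\theta e_i<\theta'e_j$ iff $\theta<\theta'$ or ($\theta=\theta'$, $i<j$). For nonzero $f$: $u_f$, $v_f$ are the $<_x$-, $<_\partial$-greatest terms appearing in $f$; $lc_x(f)$ is the coefficient of $u_f$. A Gröbner basis of $N$ w.r.t. $<_\partial$ is a finite set of nonzero elements $g_1,\dots,g_r$ of $N$ such that for each nonzero $f\in N$ some $v_{g_i}$ divides $v_f$. $S_x(f,g)=lc_x(f)^{-1}\frac{lcm(u_f,u_g)}{u_f}f-lc_x(g)^{-1}\frac{lcm(u_f,u_g)}{u_g}g$, and $S_x(f,g)=0$ if $lcm(u_f,u_g)=0$. $f$ is $(x,\partial)$-reduced w.r.t. nonzero $g$ if $f$ contains no term $\theta u_g$ with $ord_\partial(\theta v_g)\le ord_\partial v_f$. One-step reduction $f\to h$ modulo $g$: $f$ contains a term $w$ with coefficient $a\ne0$, $u_g\mid w$, $ord_\partial((w/u_g)v_g)\le ord_\partial v_f$, and $h=f-a\,lc_x(g)^{-1}(w/u_g)g$. $f$ $(x,\partial)$-reduces to $h$ modulo $G$ if $h$ arises from $f$ by a finite (possibly empty) sequence of one-step reductions by elements of $G$. With $d(f)=ord_\partial v_f-ord_\partial u_f$: a finite set $G$ of nonzero elements of $N$ is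 an $(x,\partial)$-Gröbner basis of $N$ if for every nonzero $f\in N$ some $g_i\in G$ satisfies $u_{g_i}\mid u_f$ and $d(g_i)\le d(f)$. *)

(* Defs.v *)
From HB Require Import structures.
From mathcomp Require Import all_boot all_order all_algebra.
From mathcomp Require Import finmap.
From mathcomp.multinomials Require Import monalg.
Set Implicit Arguments. Unset Strict Implicit. Unset Printing Implicit Defensive.
Import Order.TTheory GRing.Theory Num.Theory.
Local Open Scope ring_scope.

Section Weyl.
Variables (K : fieldType) (n : nat).

Definition mi := n.-tuple nat.
Definition mi_add (a b : mi) : mi := [tuple (tnth a i + tnth b i)%N | i < n].
Definition mi_sub (a b : mi) : mi := [tuple (tnth a i - tnth b i)%N | i < n].
Definition mi_max (a b : mi) : mi := [tuple maxn (tnth a i) (tnth b i) | i < n].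
Definition mi_le (a b : mi) : bool := [forall i, (tnth a i <= tnth b i)%N].
Definition mi_unit (j : 'I_n) : mi := [tuple (nat_of_bool (i == j)) | i < n].
Definition mi_abs (a : mi) : nat := (\sum_(i < n) tnth a i)%N.

(* a term x^alpha d^beta e_i, encoded as ((alpha, beta), i); the index i is a
   natural number, the free module of rank m being the span of terms with i < m *)
Definition term := (mi * mi * nat)%type.
Definition tx (t : term) : mi := t.1.1.
Definition td (t : term) : mi := t.1.2.
Definition ti (t : term) : nat := t.2.
Definition ordx (t : term) : nat := mi_abs (tx t).
Definition ordd (t : term) : nat := mi_abs (td t).

Definition E := {malg K[term]}.

(* monomials theta = x^alpha d^beta of Theta, as (alpha, beta) *)
Definition monom := (mi * mi)%type.
(* theta w for a term w (formal product, no commutation) *)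
Definition tmul (th : monom) (w : term) : term :=
  (mi_add th.1 (tx w), mi_add th.2 (td w), ti w).
Definition tdivides (u w : term) : bool :=
  [&& ti u == ti w, mi_le (tx u) (tx w) & mi_le (td u) (td w)].
Definition tquot (w u : term) : monom := (mi_sub (tx w) (tx u), mi_sub (td w) (td u)).
Definition tlcm (u w : term) : term := (mi_max (tx u) (tx w), mi_max (td u) (td w), ti u).

Definition lin_ext (phi : term -> E) (f : E) : E :=
  \sum_(t <- msupp f) f@_t *: phi t.
Definition actX (j : 'I_n) : E -> E :=
  lin_ext (fun t => << (mi_add (tx t) (mi_unit j), td t, ti t) >>).
Definition actD (j : 'I_n) : E -> E :=
  lin_ext (fun t => << (tx t, mi_add (td t) (mi_unit j), ti t) >>
                    + (tnth (tx t) j)%:R *: << (mi_sub (tx t) (mi_unit j), td t, ti t) >>).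
Definition actXs (a : mi) (f : E) : E :=
  foldr (fun j g => iter (tnth a j) (actX j) g) f (enum 'I_n).
Definition actDs (b : mi) (f : E) : E :=
  foldr (fun j g => iter (tnth b j) (actD j) g) f (enum 'I_n).
Definition mact (th : monom) (f : E) : E := actXs th.1 (actDs th.2 f).

Definition in_free (m : nat) (f : E) : Prop := forall t, t \in msupp f -> (ti t < m)%N.
Definition is_submodule (m : nat) (N : E -> Prop) : Prop :=
  [/\ forall f, N f -> in_free m f,
      N 0,
      forall f g, N f -> N g -> N (f + g),
      forall (c : K) f, N f -> N (c *: f) &
      (forall j f, N f -> N (actX j f)) /\ (forall j f, N f -> N (actD j f))].

Fixpoint lexlt (s1 s2 : seq nat) : bool :=
  match s1, s2 with
  | x :: s, y :: s' => (x < y)%N || ((x == y) && lexlt s s')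
  | _, _ => false
  end.
Definition keyx (t : term) : seq nat :=
  [:: ordx t; ordd t] ++ (tx t : seq nat) ++ (td t : seq nat) ++ [:: ti t].
Definition keyd (t : term) : seq nat :=
  [:: ordd t; ordx t] ++ (td t : seq nat) ++ (tx t : seq nat) ++ [:: ti t].
Definition ltx (t t' : term) : bool := lexlt (keyx t) (keyx t').
Definition ltd (t t' : term) : bool := lexlt (keyd t) (keyd t').

Definition default_term : term := ([tuple 0%N | i < n], [tuple 0%N | i < n], 0%N).
Definition maxby (lt : term -> term -> bool) (s : seq term) : term :=
  match s with
  | [::] => default_term
  | t :: s' => foldr (fun t' acc => if lt acc t' then t' else acc) t s'
  end.
Definition u_ (f : E) : term := maxby ltx (msupp f).
Definition v_ (f : E) : term := maxby ltd (msupp f).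
Definition lcx (f : E) : K := f@_(u_ f).

Definition Sx (f g : E) : E :=
  if ti (u_ f) == ti (u_ g) then
    let L := tlcm (u_ f) (u_ g) in
    (lcx f)^-1 *: mact (tquot L (u_ f)) f - (lcx g)^-1 *: mact (tquot L (u_ g)) g
  else 0.

Definition onestep (g f h : E) : Prop :=
  exists w, [/\ w \in msupp f, tdivides (u_ g) w,
    (ordd (tmul (tquot w (u_ g)) (v_ g)) <= ordd (v_ f))%N &
    h = f - (f@_w / lcx g) *: mact (tquot w (u_ g)) g].

Inductive xdreduces (G : seq E) : E -> E -> Prop :=
| xdred_refl f : xdreduces G f f
| xdred_step g f h k : g \in G -> onestep g f h -> xdreduces G h k -> xdreduces G f k.

Definition groebner_d (N : E -> Prop) (G : seq E) : Prop :=
  (forall g, g \in G -> g != 0 /\ N g) /\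
  (forall f, N f -> f != 0 -> exists2 g, g \in G & tdivides (v_ g) (v_ f)).

Definition dval (f : E) : int := (ordd (v_ f))%:Z - (ordd (u_ f))%:Z.

Definition groebner_xd (N : E -> Prop) (G : seq E) : Prop :=
  (forall g, g \in G -> g != 0 /\ N g) /\
  (forall f, N f -> f != 0 ->
     exists2 g, g \in G & tdivides (u_ g) (u_ f) /\ dval g <= dval f).

End Weyl.

(* Main.v *)
Require Import Defs.
From HB Require Import structures.
From mathcomp Require Import all_boot all_order all_algebra.
From mathcomp Require Import finmap zify.
From mathcomp.multinomials Require Import monalg.
Set Implicit Arguments. Unset Strict Implicit. Unset Printing Implicit Defensive.
Import Order.TTheory GRing.Theory Num.Theory.
Local Open Scope ring_scope.

(** Let f be a nonzero element of N and b = ord_d(v_f). Division with respect to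
    <_d writes f as a sum of c theta g, g in G, with ord_d(theta v_g) <= b. Among
    such representations of f take one for which the <_x-greatest w among the terms
    theta u_g is minimal. If w does not appear in f, the summands with
    theta u_g = w cancel at w, so they combine into multiples tau S_x(g, h) plus
    commutator terms of lower ord_x; replacing each S_x(g, h) by the representation
    read off from its reduction to 0 respects the bound b and lowers w, a
    contradiction. Hence w = u_f, and a summand with theta u_g = u_f gives
    d(g) <= d(f). *)

(** * Arithmetic of multi-indices *)

Section MultiIndex.
Variable n : nat.
Implicit Types (a b c : mi n) (i j k : 'I_n).

Definition mi0 : mi n := [tuple 0%N | i < n].

Lemma tnth_mi0 i : tnth mi0 i = 0%N.
Proof. exact: tnth_mktuple. Qed.

Lemma tnth_mi_add a b i : tnth (mi_add a b) i = (tnth a i + tnth b i)%N.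
Proof. exact: tnth_mktuple. Qed.

Lemma tnth_mi_sub a b i : tnth (mi_sub a b) i = (tnth a i - tnth b i)%N.
Proof. exact: tnth_mktuple. Qed.

Lemma tnth_mi_max a b i : tnth (mi_max a b) i = maxn (tnth a i) (tnth b i).
Proof. exact: tnth_mktuple. Qed.

Lemma tnth_mi_unit j i : tnth (mi_unit j) i = (i == j).
Proof. exact: tnth_mktuple. Qed.

Definition tnth_miE :=
  (tnth_mi0, tnth_mi_add, tnth_mi_sub, tnth_mi_max, tnth_mi_unit).

Lemma mi_leP a b : reflect (forall i, (tnth a i <= tnth b i)%N) (mi_le a b).
Proof. exact: forallP. Qed.

Lemma mi_addC : commutative (@mi_add n).
Proof. by move=> a b; apply: eq_from_tnth => i; rewrite !tnth_miE addnC. Qed.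

Lemma mi_addA : associative (@mi_add n).
Proof. by move=> a b c; apply: eq_from_tnth => i; rewrite !tnth_miE addnA. Qed.

Lemma mi_add0 a : mi_add mi0 a = a.
Proof. by apply: eq_from_tnth => i; rewrite !tnth_miE. Qed.

Lemma mi_addK a b : mi_sub (mi_add a b) b = a.
Proof. by apply: eq_from_tnth => i; rewrite !tnth_miE addnK. Qed.

Lemma mi_subK a b : mi_le b a -> mi_add (mi_sub a b) b = a.
Proof.
by move=> /mi_leP le_ba; apply: eq_from_tnth => i; rewrite !tnth_miE subnK.
Qed.

Lemma mi_sub_unit_add j k a : (0 < tnth a j)%N ->
  mi_sub (mi_add a (mi_unit k)) (mi_unit j) =
  mi_add (mi_sub a (mi_unit j)) (mi_unit k).
Proof.
move=> aj; apply: eq_from_tnth => i; rewrite !tnth_miE.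
by have [->|//] := eqVneq i j; rewrite -addnBAC.
Qed.

Lemma mi_sub_unitC j k a :
  mi_sub (mi_sub a (mi_unit j)) (mi_unit k) =
  mi_sub (mi_sub a (mi_unit k)) (mi_unit j).
Proof. by apply: eq_from_tnth => i; rewrite !tnth_miE subnAC. Qed.

Lemma mi_le_maxl a b : mi_le a (mi_max a b).
Proof. by apply/mi_leP => i; rewrite tnth_miE leq_maxl. Qed.

Lemma mi_le_maxr a b : mi_le b (mi_max a b).
Proof. by apply/mi_leP => i; rewrite tnth_miE leq_maxr. Qed.

Lemma mi_max_le a b c : mi_le a c -> mi_le b c -> mi_le (mi_max a b) c.
Proof.
move=> /mi_leP ac /mi_leP bc; apply/mi_leP => i.
by rewrite tnth_miE geq_max ac bc.
Qed.

Lemma mi_abs_add a b : mi_abs (mi_add a b) = (mi_abs a + mi_abs b)%N.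
Proof.
by rewrite /mi_abs -big_split; apply: eq_bigr => i _; rewrite tnth_mi_add.
Qed.

Lemma mi_abs_unit j : mi_abs (mi_unit j) = 1%N.
Proof.
rewrite /mi_abs (bigD1 j) //= tnth_mi_unit eqxx big1 // => i /negPf ij.
by rewrite tnth_mi_unit ij.
Qed.

(** Induction on [mi_abs a]: a nonzero multi-index has a positive entry, from which one unit is
    removed. It reduces claims about monomials to single generators. *)
Lemma mi_ind (P : mi n -> Prop) :
  P mi0 -> (forall j a, P a -> P (mi_add (mi_unit j) a)) -> forall a, P a.
Proof.
move=> P0 PS a; have [k] := ubnP (mi_abs a); elim: k a => // k IH a lt_ak.
have [/forallP a0|] := boolP [forall i, tnth a i == 0%N].
  suff -> : a = mi0 by [].
  by apply: eq_from_tnth => i; rewrite tnth_miE (eqP (a0 i)).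
rewrite negb_forall => /existsP[j aj].
have le_ja : mi_le (mi_unit j) a.
  apply/mi_leP => i; rewrite tnth_miE.
  by case: eqP => // ->; rewrite lt0n.
rewrite -(mi_subK le_ja) mi_addC; apply/PS/IH.
by move: lt_ak; rewrite -{1}(mi_subK le_ja) mi_abs_add mi_abs_unit addn1.
Qed.

End MultiIndex.

Arguments mi0 {n}.

(** * The lexicographic order on sequences of naturals *)

Section LexicographicOrder.
Implicit Types s t r c : seq nat.

Lemma lexlt_irr s : lexlt s s = false.
Proof. by elim: s => //= x s ->; rewrite ltnn andbF. Qed.

Lemma lexlt_trans t s r : lexlt s t -> lexlt t r -> lexlt s r.
Proof.
elim: s t r => [|x s IH] [|y t] [|z r] //=.
case/orP => [xy|/andP[/eqP -> st]] /orP[yz|/andP[/eqP <- tr]].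
- by rewrite (ltn_trans xy yz).
- by rewrite xy.
- by rewrite yz.
- by rewrite eqxx (IH t r) // orbT.
Qed.

Lemma lexlt_total s t : size s = size t -> [|| s == t, lexlt s t | lexlt t s].
Proof.
elim: s t => [|x s IH] [|y t] //= [/IH]; rewrite eqseq_cons.
by case: ltngtP => //= ->; rewrite ?orbT.
Qed.

(** The effect on the keys [keyx], [keyd] of multiplying a term by a monomial. *)
Definition addseq c s := [seq (p.1 + p.2)%N | p <- zip c s].

Lemma addseq_cat c c' s s' : size c = size s ->
  addseq (c ++ c') (s ++ s') = addseq c s ++ addseq c' s'.
Proof. by move=> eq_cs; rewrite /addseq zip_cat // map_cat. Qed.

Lemma lexlt_addseq c s t : size s = size c -> size t = size c ->
  lexlt (addseq c s) (addseq c t) = lexlt s t.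
Proof.
elim: c s t => [|z c IH] [|x s] [|y t] //= [ss] [st].
by rewrite ltn_add2l eqn_add2l -/(addseq c s) -/(addseq c t) IH.
Qed.

(** The fixed length [k] is essential: [[:: 1]], [[:: 0; 1]], [[:: 0; 0; 1]], ... descends
    forever. *)
Lemma lexlt_wf (T : Type) (key : T -> seq nat) (k : nat) :
  (forall x, size (key x) = k) ->
  well_founded (fun x y => lexlt (key x) (key y)).
Proof.
move=> size_key.
(* Three nested inductions: on the length, on a bound for the head, and on the accessibility of the
   tail. The relation carries the equality of lengths, so that the length is preserved along a
   descent. *)
have acc s : size s = k ->
    Acc (fun s t => size s = size t /\ lexlt s t) s.
  clear size_key; elim: k s => [|k IH] s.
    by move/size0nil=> ->; constructor=> t [/size0nil ->].
  case: s => [|x s]; first by [].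
  have [b] := ubnP x; elim: b x s => [//|b IHb] x s lt_xb [size_s].
  elim: (IH _ size_s) (size_s) => {size_s}s _ IHs size_s.
  constructor=> -[|y t] [] /=; first by [].
  move=> [size_t] /orP[lt_yx|/andP[/eqP -> lt_ts]].
    by apply: IHb; [exact: leq_trans lt_yx _ | rewrite /= size_t size_s].
  by apply: IHs; rewrite size_t.
move=> x; move eq_s: (key x) => s; have size_s : size s = k by rewrite -eq_s.
elim: (acc s size_s) x eq_s => {size_s}s _ IH x eq_s.
constructor=> y lt_yx; apply: (IH (key y)); last by [].
by rewrite -eq_s !size_key.
Qed.

End LexicographicOrder.

(** * The Weyl algebra relations and the action of monomials *)

(* The operators act on an abstract module, because unification between
   concrete finitely supported functions does not terminate in practice. *)
Section WeylAction.
Variables (K : fieldType) (n : nat) (V : lmodType K) (e : term n -> V).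
Variables (X D : 'I_n -> {linear V -> V}).
Implicit Types (f g : V) (t : term n) (j k : 'I_n) (a b : mi n).
Implicit Types (th : monom n).

Hypothesis linear_eq : forall F G : {linear V -> V},
  (forall t, F (e t) = G (e t)) -> F =1 G.
Hypothesis XU : forall j t, X j (e t) = e (tmul (mi_unit j, mi0) t).
Hypothesis DU : forall j t, D j (e t) = e (tmul (mi0, mi_unit j) t) +
  (tnth (tx t) j)%:R *: e (mi_sub (tx t) (mi_unit j), td t, ti t).

(** The same folds as in [actXs], [actDs] and [mact], so that the results specialize to the concrete
    action by conversion. *)
Let Xs a f := foldr (fun j g => iter (tnth a j) (X j) g) f (enum 'I_n).
Let Ds b f := foldr (fun j g => iter (tnth b j) (D j) g) f (enum 'I_n).
Let M th f := Xs th.1 (Ds th.2 f).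

Lemma X_commute j k f : X j (X k f) = X k (X j f).
Proof.
apply: (linear_eq (F := X j \o X k) (G := X k \o X j)) => t /=.
by rewrite !XU /tmul /= !mi_addA [mi_add (mi_unit j) _]mi_addC.
Qed.

Lemma D_commute j k f : D j (D k f) = D k (D j f).
Proof.
apply: (linear_eq (F := D j \o D k) (G := D k \o D j)) => t /=.
rewrite !DU !linearD !linearZ /= !DU /= /tmul /tx /td /ti /=.
rewrite !mi_add0 !scalerDr !scalerA !addrA.
rewrite !mi_addA [mi_add (mi_unit j) _]mi_addC mi_sub_unitC.
rewrite -!natrM !tnth_miE.
(* Either order of differentiation puts the same coefficient on the twice lowered term: the product
   of the two exponents if [j] and [k] differ, and [p * (p - 1)] for a common exponent [p]. *)
have -> : (tnth t.1.1 k * (tnth t.1.1 j - (j == k)) =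
           tnth t.1.1 j * (tnth t.1.1 k - (k == j)))%N.
  rewrite [k == j]eq_sym; case: eqVneq => [->//|_].
  by rewrite !subn0 mulnC.
by congr (_ + _); rewrite addrAC.
Qed.

Lemma D_X_commutator j k f :
  D j (X k f) = X k (D j f) + (j == k)%:R *: f.
Proof.
apply: (linear_eq (F := D j \o X k)
  (G := (X k \o D j) \+ ((j == k)%:R \*: idfun))) => t /=.
rewrite XU !DU linearD linearZ /= !XU -addrA.
congr (_ + _).
  by rewrite /tmul /= !mi_add0.
rewrite /tmul /tx /td /ti /= !mi_add0 tnth_mi_add tnth_mi_unit natrD scalerDl.
rewrite addrC; congr (_ + _).
  case: eqVneq => [->|_]; last by rewrite !mulr0n !scale0r.
  by rewrite mi_addC mi_addK -!surjective_pairing.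
(* For exponent 0 the truncated [mi_sub] does not commute with [mi_add], but there the coefficient
   vanishes. *)
case tj: (tnth t.1.1 j) => [|x]; first by rewrite !mulr0n !scale0r.
by rewrite mi_addC mi_sub_unit_add ?tj // mi_addC.
Qed.

(** The fold applies the operators in the order of the enumeration; since they commute, the
    additional factor [F j] can be pulled out in front. *)
Lemma foldr_iter_addunit (F : 'I_n -> V -> V) j a f :
  (forall i k g, F i (F k g) = F k (F i g)) ->
  foldr (fun k g => iter (tnth (mi_add (mi_unit j) a) k) (F k) g) f
    (enum 'I_n) =
  F j (foldr (fun k g => iter (tnth a k) (F k) g) f (enum 'I_n)).
Proof.
move=> FC.
have FiterC m i k g : F i (iter m (F k) g) = iter m (F k) (F i g).
  by elim: m g => //= m IH g; rewrite FC IH.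
have FfoldC i s g :
    foldr (fun k g => iter (tnth a k) (F k) g) (F i g) s =
    F i (foldr (fun k g => iter (tnth a k) (F k) g) g s).
  by elim: s => //= k s ->; rewrite FiterC.
(* In the induction on [s] the additional factor is kept innermost; uniqueness ensures that it is
   picked up only once. *)
suff foldrE s : uniq s ->
    foldr (fun k g => iter (tnth (mi_add (mi_unit j) a) k) (F k) g) f s =
    foldr (fun k g => iter (tnth a k) (F k) g)
      (if j \in s then F j f else f) s.
  by rewrite foldrE ?enum_uniq // mem_enum FfoldC.
elim: s => //= k s IH /andP[ks /IH ->]; rewrite tnth_mi_add tnth_mi_unit inE.
rewrite [j == k]eq_sym; have [eq_kj|//] := eqVneq k j.
by rewrite eq_kj in ks *; rewrite (negPf ks) /= FfoldC FiterC.
Qed.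

Lemma iter_linear (F : {linear V -> V}) m : linear (iter m F).
Proof. by elim: m => //= m IH c f g /=; rewrite IH linearP. Qed.

Lemma foldr_iter_linear (F : 'I_n -> {linear V -> V}) a s :
  linear (fun f => foldr (fun k g => iter (tnth a k) (F k) g) f s).
Proof. by elim: s => //= k s IH c f g /=; rewrite IH iter_linear. Qed.

Lemma Xs_linear a : linear (Xs a).
Proof. exact: (foldr_iter_linear (fun j => X j) a (enum 'I_n)). Qed.

Lemma Ds_linear b : linear (Ds b).
Proof. exact: (foldr_iter_linear (fun j => D j) b (enum 'I_n)). Qed.

Lemma monom_act_linear th : linear (M th).
Proof. by move=> c f g; rewrite /M Ds_linear Xs_linear. Qed.

HB.instance Definition _ a :=
  GRing.isLinear.Build K (V) (V) *:%R (Xs a) (Xs_linear a).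
HB.instance Definition _ th :=
  GRing.isLinear.Build K (V) (V) *:%R (M th) (monom_act_linear th).

Lemma foldr_iter0 (F : 'I_n -> V -> V) f s :
  foldr (fun k g => iter (tnth (mi0 : mi n) k) (F k) g) f s = f.
Proof. by elim: s => //= k s ->; rewrite tnth_mi0. Qed.

Lemma Xs0 f : Xs mi0 f = f.
Proof. exact: foldr_iter0. Qed.

Lemma monom_act0 f : M (mi0, mi0) f = f.
Proof. by rewrite /M Xs0 /Ds foldr_iter0. Qed.

Lemma Xs_add_unit j a f : Xs (mi_add (mi_unit j) a) f = X j (Xs a f).
Proof. by apply: foldr_iter_addunit => i k g; exact: X_commute. Qed.

Lemma X_monom j a b f :
  X j (M (a, b) f) = M (mi_add (mi_unit j) a, b) f.
Proof. by rewrite /M /= Xs_add_unit. Qed.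

Lemma D_Xs j a f : D j (Xs a f) =
  Xs a (D j f) + (tnth a j)%:R *: Xs (mi_sub a (mi_unit j)) f.
Proof.
elim/mi_ind: a => [|k a IH]; first by rewrite tnth_mi0 scale0r addr0 !Xs0.
rewrite !Xs_add_unit D_X_commutator IH linearD linearZ /= -Xs_add_unit -addrA.
congr (_ + _); rewrite tnth_mi_add tnth_mi_unit natrD scalerDl addrC.
congr (_ + _).
  case: eqVneq => [->|_]; last by rewrite !mulr0n !scale0r.
  by rewrite mi_addC mi_addK.
case aj: (tnth a j) => [|x]; first by rewrite !mulr0n !scale0r.
by rewrite [mi_add _ a]mi_addC mi_sub_unit_add ?aj // mi_addC Xs_add_unit.
Qed.

Lemma D_monom j a b f : D j (M (a, b) f) =
  M (a, mi_add (mi_unit j) b) f +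
  (tnth a j)%:R *: M (mi_sub a (mi_unit j), b) f.
Proof.
rewrite /M /= D_Xs; congr (Xs _ _ + _).
by rewrite /Ds foldr_iter_addunit // => i k g; exact: D_commute.
Qed.

(** Derivations are adjoined while the x-part is still trivial, so the commutator term of [D_monom]
    vanishes in every derivation step. *)
Lemma monom_ind (P : monom n -> Prop) :
  P (mi0, mi0) ->
  (forall j b, P (mi0, b) -> P (mi0, mi_add (mi_unit j) b)) ->
  (forall j a b, P (a, b) -> P (mi_add (mi_unit j) a, b)) ->
  forall th, P th.
Proof.
move=> P0 PD PX [a b]; elim/mi_ind: a => [|j a]; last exact: PX.
by elim/mi_ind: b => // j b; exact: PD.
Qed.

End WeylAction.

(** * The orders [<_x] and [<_d] on terms *)

Section TermOrders.
Variable n : nat.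
Implicit Types (s t w : term n) (th : monom n) (a b : mi n).

(** What [<_x] and [<_d] have in common, so that leading terms are studied once for both. The field
    [term_order_deg] makes commutator terms negligible: they lose in both degrees. *)
Record term_order (lt : rel (term n)) : Prop := TermOrder {
  term_order_irr : irreflexive lt;
  term_order_trans : transitive lt;
  term_order_total : forall s t, [|| s == t, lt s t | lt t s];
  term_order_mul : forall th s t, lt (tmul th s) (tmul th t) = lt s t;
  term_order_deg : forall s t,
    (ordx s < ordx t)%N -> (ordd s < ordd t)%N -> lt s t;
  term_order_wf : well_founded lt
}.

Lemma mi_add_addseq a b : mi_add a b = addseq a b :> seq nat.
Proof.
apply: (@eq_from_nth _ 0%N).
  by rewrite (size_tuple (mi_add a b)) size_map size_zip !size_tuple minnn.
move=> i; rewrite (size_tuple (mi_add a b)) => lt_in.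
rewrite (nth_map (0, 0)%N) ?size_zip ?size_tuple ?minnn //.
rewrite nth_zip ?size_tuple //=.
by have := tnth_mi_add a b (Ordinal lt_in); rewrite !(tnth_nth 0%N).
Qed.

(** The monomial is read as a term of index 0, so that adding keys leaves the index of [t]
    unchanged. *)
Lemma keyx_mul th t : keyx (tmul th t) = addseq (keyx (th, 0%N)) (keyx t).
Proof.
rewrite /keyx !addseq_cat ?size_tuple // -!mi_add_addseq /tmul.
by rewrite /addseq /= /ordx /ordd !mi_abs_add.
Qed.

Lemma keyd_mul th t : keyd (tmul th t) = addseq (keyd (th, 0%N)) (keyd t).
Proof.
rewrite /keyd !addseq_cat ?size_tuple // -!mi_add_addseq /tmul.
by rewrite /addseq /= /ordx /ordd !mi_abs_add.
Qed.

Lemma size_keyx t : size (keyx t) = (n + (n + 1)).+2.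
Proof. by rewrite /= !size_cat !size_tuple. Qed.

Lemma size_keyd t : size (keyd t) = (n + (n + 1)).+2.
Proof. by rewrite /= !size_cat !size_tuple. Qed.

Lemma keyx_inj : injective (@keyx n).
Proof.
move=> [[a b] i] [[a' b'] i'] [_ _]; rewrite /tx /td /ti /= => /eqP.
rewrite eqseq_cat ?size_tuple // eqseq_cat ?size_tuple //.
by case/and3P=> /eqP/val_inj -> /eqP/val_inj -> /eqP[->].
Qed.

Lemma keyd_inj : injective (@keyd n).
Proof.
move=> [[a b] i] [[a' b'] i'] [_ _]; rewrite /tx /td /ti /= => /eqP.
rewrite eqseq_cat ?size_tuple // eqseq_cat ?size_tuple //.
by case/and3P=> /eqP/val_inj -> /eqP/val_inj -> /eqP[->].
Qed.

Lemma ltx_order : term_order (@ltx n).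
Proof.
split=> [t|t s w|s t|th s t|s t lt_x lt_d|].
- exact: lexlt_irr.
- exact: lexlt_trans.
- by rewrite -(inj_eq keyx_inj) lexlt_total // !size_keyx.
- by rewrite /ltx !keyx_mul lexlt_addseq // !size_keyx.
- by rewrite /ltx /= lt_x.
- exact: lexlt_wf size_keyx.
Qed.

Lemma ltd_order : term_order (@ltd n).
Proof.
split=> [t|t s w|s t|th s t|s t lt_x lt_d|].
- exact: lexlt_irr.
- exact: lexlt_trans.
- by rewrite -(inj_eq keyd_inj) lexlt_total // !size_keyd.
- by rewrite /ltd !keyd_mul lexlt_addseq // !size_keyd.
- by rewrite /ltd /= lt_d.
- exact: lexlt_wf size_keyd.
Qed.

Lemma ltd_ordd s t : ltd s t -> (ordd s <= ordd t)%N.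
Proof. by case/orP => [/ltnW //|/andP[/eqP ->]]. Qed.

Lemma maxby_mem (lt : rel (term n)) (r : seq (term n)) t :
  t \in r -> maxby lt r \in r.
Proof.
case: r => // t0 r _ /=; elim: r => [|s r]; first exact: mem_head.
rewrite /= !inE; case: ifP => _; first by rewrite eqxx orbT.
by case/orP => ->; rewrite ?orbT.
Qed.

Lemma maxby_max (lt : rel (term n)) (r : seq (term n)) t :
  term_order lt -> t \in r -> (t == maxby lt r) || lt t (maxby lt r).
Proof.
move=> ord; case: r => // t0 r /=; elim: r => [|s r IH] /=.
  by rewrite inE => ->.
set w := foldr _ _ _ in IH *; rewrite !inE.
have IHlt : (t == t0) || (t \in r) -> forall w', lt w w' -> lt t w'.
  rewrite -in_cons => /IH/orP[/eqP -> //|lt_tw w'].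
  exact: (term_order_trans ord).
rewrite orbCA => /orP[/eqP ->|/[dup] tr /IHlt lt_t].
  case: ifP => [_|lt_ws]; first by rewrite eqxx.
  have := term_order_total ord s w; rewrite lt_ws orbF.
  by case/orP => ->; rewrite ?orbT.
by case: ifP => [/lt_t -> | _]; rewrite ?orbT // IH.
Qed.

End TermOrders.

(* Locked, because unification tries to unfold << t >>. *)
HB.lock Definition bas (K : fieldType) (n : nat) (t : term n) : E K n :=
  << t >>.
Arguments bas {K n} t.

Lemma malgZU (R : nzRingType) (T : choiceType) (c : R) (t : T) :
  << c *g t >> = c *: << t >>.
Proof. by apply/malgP => s; rewrite mcoeffZ !mcoeffU mulrnAr mulr1. Qed.

(** Meant for [x], [x'] iterated actions of two monomials and [y], [y'] the actions of their formal
    products: an S-polynomial is corrected by two commutator remainders. *)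
Lemma telescope_scale (R : nzRingType) (V : lmodType R) (c c' : R)
    (x x' y y' : V) :
  c *: x - c' *: x' - c *: (x - y) + c' *: (x' - y') = c *: y - c' *: y'.
Proof.
rewrite !scalerBr opprB [_ + (c *: y - _)]addrC.
by rewrite [_ + (c *: x - _)]addrA subrK addrA subrK.
Qed.

(** Trades a multiple of [x] for one of [x'] at the cost of an S-polynomial; [b] and [b'] will be
    leading coefficients. *)
Lemma collect_scale (F : fieldType) (V : lmodType F) (a b b' c : F)
    (x x' y : V) : b != 0 ->
  a *: x + y - (a * b / b' + c) *: x' =
  (a * b) *: (b^-1 *: x - b'^-1 *: x') + (y - c *: x').
Proof.
move=> b0; rewrite scalerBr !scalerA mulfK // scalerDl opprD !addrA.
by congr (_ - _); rewrite addrAC.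
Qed.

(** * Predicates on the support of an element *)

Section Support.
Variables (K : fieldType) (n : nat).
Implicit Types (f g : E K n) (s t w : term n) (c : K).
Implicit Types (P Q : term n -> Prop).

Lemma E_expand f : f = \sum_(t <- msupp f) f@_t *: bas t.
Proof.
rewrite {1}[f]monalgE; apply: eq_bigr => t _.
by rewrite malgZU bas.unlock.
Qed.

Lemma mcoeff_bas s t : (bas s : E K n)@_t = (s == t)%:R.
Proof. by rewrite bas.unlock mcoeffU. Qed.

Definition supp_in P f := forall t, t \in msupp f -> P t.

Lemma supp_in0 P : supp_in P 0.
Proof. by move=> t; rewrite msupp0 inE. Qed.

Lemma supp_inD P f g : supp_in P f -> supp_in P g -> supp_in P (f + g).
Proof.
move=> Pf Pg t /(fsubsetP (msuppD_le f g)); rewrite inE.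
by case/orP => [/Pf|/Pg].
Qed.

Lemma supp_inZ P c f : supp_in P f -> supp_in P (c *: f).
Proof. by move=> Pf t /(fsubsetP (msuppZ_le c f))/Pf. Qed.

Lemma supp_inB P f g : supp_in P f -> supp_in P g -> supp_in P (f - g).
Proof.
by move=> Pf Pg; rewrite -scaleN1r; apply: supp_inD => //; exact: supp_inZ.
Qed.

Lemma supp_in_sub P Q f : (forall t, P t -> Q t) -> supp_in P f -> supp_in Q f.
Proof. by move=> PQ Pf t /Pf/PQ. Qed.

Lemma supp_in_bas P t : P t -> supp_in P (bas t : E K n).
Proof.
move=> Pt s; rewrite -mcoeff_neq0 mcoeff_bas.
by case: (eqVneq t s) => [<-|_] //; rewrite eqxx.
Qed.

Lemma supp_in_sum P (r : seq (term n)) (F : term n -> E K n) :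
  (forall t, t \in r -> supp_in P (F t)) -> supp_in P (\sum_(t <- r) F t).
Proof.
move=> PF; rewrite big_seq.
by apply: (big_ind (supp_in P)) => //; [exact: supp_in0 | exact: supp_inD].
Qed.

Lemma supp_in_linear P Q (F : {linear E K n -> E K n}) f :
  supp_in P f -> (forall t, P t -> supp_in Q (F (bas t))) -> supp_in Q (F f).
Proof.
move=> Pf QF; rewrite [f]E_expand linear_sum.
apply: supp_in_sum => t /Pf Pt; rewrite linearZ.
by apply: supp_inZ; exact: QF.
Qed.

End Support.

(** * Leading terms under the action of monomials *)

Section LeadingTerms.
Variables (K : fieldType) (n : nat).
Variables (X D : 'I_n -> {linear E K n -> E K n}).
Variable M : monom n -> {linear E K n -> E K n}.
Implicit Types (f g : E K n) (s t w : term n) (th : monom n).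
Implicit Types (j k : 'I_n) (a b : mi n).

Hypothesis XU : forall j t, X j (bas t) = bas (tmul (mi_unit j, mi0) t).
Hypothesis DU : forall j t, D j (bas t) = bas (tmul (mi0, mi_unit j) t) +
  (tnth (tx t) j)%:R *: bas (mi_sub (tx t) (mi_unit j), td t, ti t).
Hypothesis M0 : forall f, M (mi0, mi0) f = f.
Hypothesis X_M : forall j a b f,
  X j (M (a, b) f) = M (mi_add (mi_unit j) a, b) f.
Hypothesis D_M : forall j a b f, D j (M (a, b) f) =
  M (a, mi_add (mi_unit j) b) f +
  (tnth a j)%:R *: M (mi_sub a (mi_unit j), b) f.

(** The place of the error terms of noncommutativity: each contraction of a derivation with a
    variable removes one of both. *)
Definition below w s := (ordx s < ordx w)%N /\ (ordd s < ordd w)%N.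

Lemma ordx_mul th t : ordx (tmul th t) = (mi_abs th.1 + ordx t)%N.
Proof. exact: mi_abs_add. Qed.

Lemma ordd_mul th t : ordd (tmul th t) = (mi_abs th.2 + ordd t)%N.
Proof. exact: mi_abs_add. Qed.

Lemma mi_abs_sub a b : (mi_abs (mi_sub a b) <= mi_abs a)%N.
Proof. by apply: leq_sum => i _; rewrite tnth_mi_sub leq_subr. Qed.

Lemma mi_abs_sub_unit j a : (0 < tnth a j)%N ->
  (mi_abs (mi_sub a (mi_unit j)) < mi_abs a)%N.
Proof.
move=> aj; have le_ja : mi_le (mi_unit j) a.
  by apply/mi_leP => i; rewrite tnth_miE; case: eqP => // ->.
by rewrite -[X in (_ < mi_abs X)%N](mi_subK le_ja) mi_abs_add mi_abs_unit addn1.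
Qed.

Lemma mi_abs0 : mi_abs (mi0 : mi n) = 0%N.
Proof. by rewrite /mi_abs big1 // => i _; rewrite tnth_mi0. Qed.

Lemma tmulA a b a' b' t :
  tmul (a, b) (tmul (a', b') t) = tmul (mi_add a a', mi_add b b') t.
Proof. by rewrite /tmul /= !mi_addA. Qed.

Lemma tmul0 t : tmul (mi0, mi0) t = t.
Proof. by rewrite /tmul /= !mi_add0; case: t => [[]]. Qed.

Lemma below_X j w f : supp_in (below w) f ->
  supp_in (below (tmul (mi_unit j, mi0) w)) (X j f).
Proof.
move=> low; apply: (supp_in_linear low) => t [lt_x lt_d].
rewrite XU; apply: supp_in_bas.
by split; rewrite ?ordx_mul ?ordd_mul /= ltn_add2l.
Qed.

Lemma below_D j w f : supp_in (below w) f ->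
  supp_in (below (tmul (mi0, mi_unit j) w)) (D j f).
Proof.
move=> low; apply: (supp_in_linear low) => t [lt_x lt_d].
rewrite DU; apply: supp_inD; last apply: supp_inZ; apply: supp_in_bas.
  by split; rewrite ?ordx_mul ?ordd_mul /= ltn_add2l.
split; rewrite ?ordx_mul ?ordd_mul /= ?mi_abs0 ?mi_abs_unit.
  exact: leq_ltn_trans (mi_abs_sub _ _) lt_x.
exact: leq_trans lt_d (leq_addl _ _).
Qed.

(** The action agrees with the formal product up to error terms. Adjoining a generator keeps old
    errors below the new product, and only [D j] creates a new one. *)
Lemma M_bas th t :
  supp_in (below (tmul th t)) (M th (bas t) - bas (tmul th t)).
Proof.
elim/monom_ind: th => [|j b IH|j a b IH].
- by rewrite M0 tmul0 subrr; exact: supp_in0.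
- have -> : M (mi0, mi_add (mi_unit j) b) (bas t) =
      D j (M (mi0, b) (bas t)).
    by rewrite D_M tnth_mi0 scale0r addr0.
  have -> : tmul (mi0, mi_add (mi_unit j) b) t =
      tmul (mi0, mi_unit j) (tmul (mi0, b) t) by rewrite tmulA mi_add0.
  move: (tmul (mi0, b) t) (M _ _) IH => w h IH.
  have -> : D j h = D j (h - bas w) + D j (bas w) by rewrite -linearD subrK.
  rewrite -addrA; apply: supp_inD; first by exact: below_D IH.
  rewrite DU addrC addKr.
  (* The new error term lies below only if [x_j] occurs in [w]; otherwise its coefficient is 0. *)
  have [->|xw] := posnP (tnth (tx w) j).
    by rewrite scale0r; exact: supp_in0.
  apply: supp_inZ; apply: supp_in_bas.
  split; rewrite ?ordx_mul ?ordd_mul /= ?mi_abs0 ?mi_abs_unit.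
    exact: mi_abs_sub_unit.
  exact: ltnSn.
- rewrite -X_M.
  have -> : tmul (mi_add (mi_unit j) a, b) t =
      tmul (mi_unit j, mi0) (tmul (a, b) t) by rewrite tmulA mi_add0.
  by rewrite -XU -linearB; exact: below_X.
Qed.

Section Order.
Variable lt : rel (term n).
Hypothesis ord : term_order lt.

Definition le_ lt w : term n -> Prop := fun s => (s == w) || lt s w.

Lemma M_supp th w f : supp_in (le_ lt w) f ->
  supp_in (le_ lt (tmul th w)) (M th f).
Proof.
move=> le_f; apply: (supp_in_linear le_f) => t le_t.
rewrite -(subrK (bas (tmul th t)) (M th (bas t))).
have le_tw : (tmul th t == tmul th w) || lt (tmul th t) (tmul th w).
  case/orP: le_t => [/eqP ->|lt_tw]; first by rewrite eqxx.
  by rewrite (term_order_mul ord) lt_tw orbT.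
apply: supp_inD; last exact: supp_in_bas.
apply: supp_in_sub (@M_bas th t) => s [lt_x lt_d].
have lt_s := term_order_deg ord lt_x lt_d; apply/orP; right.
case/orP: le_tw => [/eqP <- //|]; exact: (term_order_trans ord) lt_s.
Qed.

Lemma M_supp_lt th w f : supp_in (fun s => lt s w) f ->
  supp_in (fun s => lt s (tmul th w)) (M th f).
Proof.
move=> lt_f; apply: (supp_in_linear lt_f) => t lt_tw.
have lt_w : lt (tmul th t) (tmul th w) by rewrite (term_order_mul ord).
rewrite -(subrK (bas (tmul th t)) (M th (bas t))).
apply: supp_inD; last exact: supp_in_bas.
apply: supp_in_sub (@M_bas th t) => s [lt_x lt_d].
exact: (term_order_trans ord) (term_order_deg ord lt_x lt_d) lt_w.
Qed.

Lemma supp_maxby f : supp_in (le_ lt (maxby lt (msupp f))) f.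
Proof. by move=> t; exact: maxby_max. Qed.

(** Terms of [f] under [w] stay under the product, and the error terms of [w] itself are smaller by
    [term_order_deg], so nothing else contributes to this coefficient. *)
Lemma M_coef th w f : supp_in (le_ lt w) f ->
  (M th f)@_(tmul th w) = f@_w.
Proof.
move=> le_f; pose f' := f - f@_w *: bas w.
have lt_f' : supp_in (fun s => lt s w) f'.
  move=> s sf'; have sw : s != w.
    apply: contraTneq sf' => ->.
    by rewrite -mcoeff_eq0 mcoeffB mcoeffZ mcoeff_bas eqxx mulr1 subrr.
  have : s \in msupp f.
    move: sf'; rewrite -!mcoeff_neq0 mcoeffB mcoeffZ mcoeff_bas.
    by rewrite [w == s]eq_sym (negPf sw) mulr0 subr0.
  by move/le_f/orP; rewrite (negPf sw) => -[].
have out0 h : supp_in (fun s => lt s (tmul th w)) h -> h@_(tmul th w) = 0.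
  move=> lt_h; apply/eqP; rewrite mcoeff_eq0; apply/negP => /lt_h.
  by rewrite (term_order_irr ord).
have -> : f = f' + f@_w *: bas w by rewrite subrK.
rewrite linearD linearZ mcoeffD mcoeffZ out0 ?add0r; last exact: M_supp_lt.
rewrite -(subrK (bas (tmul th w)) (M th (bas w))) mcoeffD out0 ?add0r.
  rewrite mcoeff_bas eqxx mcoeffD mcoeffZ mcoeff_bas eqxx.
  rewrite [X in _ = X + _](_ : _ = 0) ?add0r //.
  apply/eqP; rewrite mcoeff_eq0; apply/negP => /lt_f'.
  by rewrite (term_order_irr ord).
apply: supp_in_sub (@M_bas th w) => s [lt_x lt_d].
exact: term_order_deg.
Qed.

End Order.

Lemma maxby_msupp (lt : rel (term n)) f :
  f != 0 -> maxby lt (msupp f) \in msupp f.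
Proof.
move=> f0; have [t tf] : exists t, t \in msupp f; last exact: maxby_mem tf.
case eq_f: (enum_fset (msupp f)) => [|t r].
  by case/eqP: f0; rewrite [f]E_expand eq_f big_nil.
by exists t; rewrite -[_ \in _]/(t \in enum_fset (msupp f)) eq_f mem_head.
Qed.

Lemma lcx_neq0 f : f != 0 -> lcx f != 0.
Proof. by move=> f0; rewrite mcoeff_neq0; exact: maxby_msupp. Qed.

(** Since [<_d] compares [ord_d] first, bounding terms by the leading one bounds their [ord_d]. *)
Lemma M_supp_ordd th f :
  supp_in (fun t => (ordd t <= ordd (tmul th (v_ f)))%N) (M th f).
Proof.
apply: supp_in_sub (M_supp (@ltd_order n) (supp_maxby (@ltd_order n) (f := f))).
by move=> t /orP[/eqP ->|/ltd_ordd].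
Qed.

Lemma M_supp_u th f : supp_in (le_ (@ltx n) (tmul th (u_ f))) (M th f).
Proof.
exact: (@M_supp _ (@ltx_order n) th _ _
  (@supp_maxby _ (@ltx_order n) f)).
Qed.

Lemma M_coef_u th f : (M th f)@_(tmul th (u_ f)) = lcx f.
Proof.
exact: (@M_coef _ (@ltx_order n) th _ _
  (@supp_maxby _ (@ltx_order n) f)).
Qed.

Lemma M_coef_v th f : (M th f)@_(tmul th (v_ f)) = f@_(v_ f).
Proof.
exact: (@M_coef _ (@ltd_order n) th _ _
  (@supp_maxby _ (@ltd_order n) f)).
Qed.

Lemma tmulK th t : tquot (tmul th t) t = th.
Proof. by rewrite /tquot /tmul /= !mi_addK -surjective_pairing. Qed.

Lemma tdivides_mul th t : tdivides t (tmul th t).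
Proof.
by rewrite /tdivides eqxx /=; apply/andP; split; apply/mi_leP => i;
  rewrite tnth_miE leq_addl.
Qed.

Lemma tquotK s t : tdivides s t -> tmul (tquot t s) s = t.
Proof.
case/and3P => /eqP eq_i le_x le_d; rewrite /tmul /= !mi_subK // eq_i.
by case: t {eq_i le_x le_d} => [[]].
Qed.

Lemma tdivides_lcml s t : tdivides s (tlcm s t).
Proof. by rewrite /tdivides eqxx !mi_le_maxl. Qed.

Lemma tdivides_lcmr s t : ti s = ti t -> tdivides t (tlcm s t).
Proof.
move=> eq_i; rewrite /tdivides /= /ti /= -/(ti s) eq_i eqxx.
by rewrite !mi_le_maxr.
Qed.

Lemma tlcm_divides s t w :
  tdivides s w -> tdivides t w -> tdivides (tlcm s t) w.
Proof.
case/and3P => /eqP eq_i sx sd /and3P[_ tx_ td_].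
by rewrite /tdivides /= /ti /= -/(ti s) -/(ti w) eq_i eqxx !mi_max_le.
Qed.

(** * Representations by multiples of elements of [G] with bounded [ord_d] *)

Section Representations.
Variable G : seq (E K n).
Hypothesis G_neq0 : forall g, g \in G -> g != 0.

(** A witness that [f] is a finite sum of multiples [c theta g]. The bound [B] on [ord_d] will yield
    the inequality between the values of [d], while [P] tracks how far the terms [theta u_g] have
    been lowered for [<_x]. *)
Inductive rep (B : nat) (P : term n -> Prop) : E K n -> Prop :=
| rep_nil : rep B P 0
| rep_cons c th g f : g \in G -> (ordd (tmul th (v_ g)) <= B)%N ->
    P (tmul th (u_ g)) -> rep B P f -> rep B P (c *: M th g + f).

Implicit Types (B : nat) (P Q : term n -> Prop).

Lemma rep_one B P c th g : g \in G -> (ordd (tmul th (v_ g)) <= B)%N ->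
  P (tmul th (u_ g)) -> rep B P (c *: M th g).
Proof.
by move=> Gg le_b Pu; rewrite -[c *: _]addr0; apply: rep_cons => //; left.
Qed.

Lemma rep_sub B B' P Q f : (B <= B')%N -> (forall t, P t -> Q t) ->
  rep B P f -> rep B' Q f.
Proof.
move=> le_b PQ; elim=> [|c th g h Gg le_g Pu _ IH]; first by left.
by right => //; [exact: leq_trans le_b | exact: PQ].
Qed.

Lemma repD B P f g : rep B P f -> rep B P g -> rep B P (f + g).
Proof.
move=> rep_f rep_g; elim: rep_f => [|c th h f' Gh le_h Pu _ IH].
  by rewrite add0r.
by rewrite -addrA; right.
Qed.

Lemma repZ B P c f : rep B P f -> rep B P (c *: f).
Proof.
elim=> [|c' th h f' Gh le_h Pu _ IH]; first by rewrite scaler0; left.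
by rewrite scalerDr scalerA; right.
Qed.

Lemma repB B P f g : rep B P f -> rep B P g -> rep B P (f - g).
Proof.
by move=> rep_f rep_g; rewrite -scaleN1r; apply: repD => //; exact: repZ.
Qed.

Lemma rep_supp_lt B w f : rep B (fun t => ltx t w) f ->
  supp_in (fun t => ltx t w) f.
Proof.
elim=> [|c th g h Gg _ lt_w _ IH]; first exact: supp_in0.
apply: supp_inD => //; apply: supp_inZ; apply: supp_in_sub (@M_supp_u th g).
move=> t /orP[/eqP -> //|lt_t]; exact: lexlt_trans lt_t lt_w.
Qed.

Lemma rep_X B w j f : rep B (fun t => ltx t w) f ->
  rep B (fun t => ltx t (tmul (mi_unit j, mi0) w)) (X j f).
Proof.
elim=> [|c [a d] g h Gg le_g lt_w _ IH]; first by rewrite linear0; left.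
rewrite linearD linearZ X_M; right => //.
by rewrite -[d]mi_add0 -tmulA (term_order_mul (@ltx_order n)).
Qed.

(* The commutator term lowers ord_x, so it stays strictly below the bound. *)
Lemma ltx_commutator j a d t : (0 < tnth a j)%N ->
  ltx (tmul (mi_sub a (mi_unit j), d) t) (tmul (a, mi_add (mi_unit j) d) t).
Proof.
move=> aj; apply: (term_order_deg (@ltx_order n)).
  by rewrite !ordx_mul /= ltn_add2r mi_abs_sub_unit.
by rewrite !ordd_mul /= mi_abs_add mi_abs_unit.
Qed.

Lemma rep_commutator B P j a d g : g \in G ->
  (ordd (tmul (a, d) (v_ g)) <= B)%N ->
  (forall t, ltx t (tmul (a, mi_add (mi_unit j) d) (u_ g)) -> P t) ->
  rep B P ((tnth a j)%:R *: M (mi_sub a (mi_unit j), d) g).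
Proof.
move=> Gg le_b Plt; have [->|aj] := posnP (tnth a j).
  by rewrite scale0r; left.
by apply: rep_one => //; apply: Plt; exact: ltx_commutator.
Qed.

Lemma tmul_D j a d t :
  tmul (mi0, mi_unit j) (tmul (a, d) t) = tmul (a, mi_add (mi_unit j) d) t.
Proof. by rewrite tmulA mi_add0. Qed.

Lemma tmul_X j a d t :
  tmul (mi_unit j, mi0) (tmul (a, d) t) = tmul (mi_add (mi_unit j) a, d) t.
Proof. by rewrite tmulA mi_add0. Qed.

Lemma ordd_D j t : ordd (tmul (mi0, mi_unit j) t) = (ordd t).+1.
Proof. by rewrite ordd_mul /= mi_abs_unit. Qed.

Lemma ordd_X j t : ordd (tmul (mi_unit j, mi0) t) = ordd t.
Proof. by rewrite ordd_mul /= mi_abs0. Qed.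

Lemma rep_D B w j f : rep B (fun t => ltx t w) f ->
  rep B.+1 (fun t => ltx t (tmul (mi0, mi_unit j) w)) (D j f).
Proof.
elim=> [|c [a d] g h Gg le_g lt_w _ IH]; first by rewrite linear0; left.
have lt_jw : ltx (tmul (a, mi_add (mi_unit j) d) (u_ g))
                 (tmul (mi0, mi_unit j) w).
  by rewrite -tmul_D (term_order_mul (@ltx_order n)).
rewrite linearD linearZ /= D_M scalerDr -addrA; right => //.
  by rewrite -tmul_D ordd_D.
apply: repD => //; apply: repZ; apply: rep_commutator => //; first exact: leqW.
by move=> t lt_t; exact: lexlt_trans lt_t lt_jw.
Qed.

(** Variables leave [B] alone, whereas each derivation raises it by one. *)
Lemma rep_M B w th f : rep B (fun t => ltx t w) f ->
  rep (mi_abs th.2 + B) (fun t => ltx t (tmul th w)) (M th f).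
Proof.
move=> rep_f; elim/monom_ind: th => [|j d IH|j a d IH].
- by rewrite M0 tmul0 mi_abs0.
- have := rep_D j IH.
  by rewrite D_M tnth_mi0 scale0r addr0 tmul_D /= mi_abs_add mi_abs_unit.
- by have := rep_X j IH; rewrite X_M tmul_X.
Qed.

(** Acting twice differs from acting by the formal product only through commutators, whose multiples
    of [g] have strictly smaller leading terms and no larger [ord_d]. *)
Lemma M_comp th a d g : g \in G ->
  rep (ordd (tmul th (tmul (a, d) (v_ g))))
    (fun t => ltx t (tmul th (tmul (a, d) (u_ g))))
    (M th (M (a, d) g) - M (mi_add th.1 a, mi_add th.2 d) g).
Proof.
move=> Gg; elim/monom_ind: th => [|j d' IH|j a' d' IH].
- by rewrite M0 /= !mi_add0 subrr; left.
- rewrite /= !mi_add0 in IH *; have := rep_D j IH.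
  rewrite linearB !D_M tnth_mi0 scale0r addr0.
  rewrite -(tmul_D j mi0 d' (tmul (a, d) (v_ g))) ordd_D.
  rewrite -(tmul_D j mi0 d' (tmul (a, d) (u_ g))) -mi_addA.
  set F := M _ (M _ g); set A := M _ g => rep_Dj.
  (* [C] arises when [D j] passes the x-part [a]. The induction hypothesis handles [F - A - C], and
     [C] is a single admissible summand. *)
  pose C := (tnth a j)%:R *: M (mi_sub a (mi_unit j), mi_add d' d) g.
  rewrite -[F - A](addrK (- C)).
  rewrite opprK -[F - A - _]addrA -opprD; apply: repD => //.
  apply: rep_commutator => //; first by rewrite tmulA mi_add0 leqnSn.
  by move=> t; rewrite !tmulA !mi_add0 mi_addA.
- have := rep_X j IH; rewrite linearB !X_M /= -mi_addA tmul_X.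
  by rewrite -[in X in rep X _ _](ordd_X j) tmul_X.
Qed.

(** The subtracted multiples form the representation. Each has a leading term occurring in the
    current element, and the side condition on [ord_d] in a reduction step supplies the bound
    [B]. *)
Lemma xdreduces_rep B w f h : (forall th f', mact th f' = M th f') ->
  xdreduces G f h -> supp_in (fun t => ltx t w) f ->
  supp_in (fun t => (ordd t <= B)%N) f -> rep B (fun t => ltx t w) (f - h).
Proof.
move=> ME; elim=> {f h} [f|g f h k Gg [s [fs us le_v ->]] _ IH] lt_f le_f.
  by rewrite subrr; left.
set c := f@_s / lcx g in IH *; rewrite ME in IH *.
set th := tquot s (u_ g) in le_v IH *.
have th_u : tmul th (u_ g) = s by exact: tquotK.
have le_th : (ordd (tmul th (v_ g)) <= B)%N.
  by apply: leq_trans le_v _; apply: le_f; exact: maxby_mem fs.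
have -> : f - k = c *: M th g + (f - c *: M th g - k).
  by rewrite [RHS]addrC addrAC subrK.
right => //; first by rewrite th_u; exact: lt_f.
(* Both support bounds survive the step, because the subtracted multiple satisfies them too. *)
apply: IH; apply: supp_inB => //; apply: supp_inZ.
  apply: supp_in_sub (@M_supp_u th g); rewrite th_u => t.
  case/orP => [/eqP ->|lt_t]; first exact: lt_f.
  exact: lexlt_trans lt_t (lt_f _ fs).
by apply: supp_in_sub (@M_supp_ordd th g) => t /leq_trans; apply.
Qed.

Lemma mcoeff_cancel f f' w (c c' : K) : c != 0 -> c' != 0 ->
  f@_w = c -> f'@_w = c' -> (c^-1 *: f - c'^-1 *: f')@_w = 0.
Proof.
move=> c0 c'0 fw f'w.
have coef1 (h : E K n) (d : K) : d != 0 -> h@_w = d -> (d^-1 *: h)@_w = 1.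
  by move=> d0 hw; apply: etrans (mcoeffZ d^-1 h w) _; rewrite hw mulVf.
apply: etrans (mcoeffB w (c^-1 *: f) (c'^-1 *: f')) _; apply/eqP.
by rewrite subr_eq0; apply/eqP;
  exact: etrans (coef1 _ _ c0 fw) (esym (coef1 _ _ c'0 f'w)).
Qed.

(** With [L] the lcm of the leading terms and [r] the quotient of [w] by [L], the difference is [r]
    applied to [Sx g h], up to the remainders of [M_comp]. *)
Lemma spoly_rep B w g h th th' : (forall q f, mact q f = M q f) ->
  g \in G -> h \in G -> xdreduces G (Sx g h) 0 ->
  tmul th (u_ g) = w -> tmul th' (u_ h) = w ->
  (ordd (tmul th (v_ g)) <= B)%N -> (ordd (tmul th' (v_ h)) <= B)%N ->
  rep B (fun t => ltx t w)
    ((lcx g)^-1 *: M th g - (lcx h)^-1 *: M th' h).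
Proof.
move=> ME Gg Gh; rewrite /Sx => red thg thh le_g le_h.
(* Both leading terms divide [w], so [Sx g h] is not in its zero branch. *)
have eq_i : ti (u_ g) = ti (u_ h) by move/(congr1 (@ti n)): (thg); rewrite -thh.
pose L := tlcm (u_ g) (u_ h); pose q := tquot L (u_ g).
pose q' := tquot L (u_ h).
pose S := (lcx g)^-1 *: M q g - (lcx h)^-1 *: M q' h.
have {}red : xdreduces G S 0.
  move: red; rewrite eq_i eqxx /=.
  rewrite (ME (tquot (tlcm (u_ g) (u_ h)) (u_ g))).
  rewrite (ME (tquot (tlcm (u_ g) (u_ h)) (u_ h))).
  exact.
have qu : tmul q (u_ g) = L by apply: tquotK; exact: tdivides_lcml.
have qu' : tmul q' (u_ h) = L by apply: tquotK; exact: tdivides_lcmr.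
have Lw : tdivides L w.
  by apply: tlcm_divides; [rewrite -thg | rewrite -thh]; exact: tdivides_mul.
clearbody q q' L.
pose r := tquot w L; have rL : tmul r L = w by exact: tquotK.
clearbody r.
have def_th : th = (mi_add r.1 q.1, mi_add r.2 q.2).
  rewrite -[th](tmulK _ (u_ g)) thg -rL -qu.
  by rewrite (surjective_pairing r) (surjective_pairing q) tmulA tmulK.
have def_th' : th' = (mi_add r.1 q'.1, mi_add r.2 q'.2).
  rewrite -[th'](tmulK _ (u_ h)) thh -rL -qu'.
  by rewrite (surjective_pairing r) (surjective_pairing q') tmulA tmulK.
have tmul_r t : tmul th t = tmul r (tmul q t).
  rewrite def_th (surjective_pairing r) (surjective_pairing q) tmulA.
  by rewrite -!surjective_pairing.
have tmul_r' t : tmul th' t = tmul r (tmul q' t).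
  rewrite def_th' (surjective_pairing r) (surjective_pairing q') tmulA.
  by rewrite -!surjective_pairing.
(* The bound for the S-polynomial itself: applying [r] adds [mi_abs r.2] back. By [le_g] the
   subtraction is not truncated. *)
pose B0 := (B - mi_abs r.2)%N.
have le_g0 : (ordd (tmul q (v_ g)) <= B0)%N.
  by move: le_g; rewrite tmul_r ordd_mul /B0; lia.
have le_h0 : (ordd (tmul q' (v_ h)) <= B0)%N.
  by move: le_h; rewrite tmul_r' ordd_mul /B0; lia.
have le_b0 : (mi_abs r.2 + B0 <= B)%N.
  by move: le_g; rewrite tmul_r ordd_mul /B0; lia.
(* The two normalized multiples both have coefficient 1 at [L], so [S] lies strictly below [L]. *)
have S_coef : S@_L = 0.
  have Mg : (M q g)@_L = lcx g by rewrite -qu M_coef_u.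
  have Mh : (M q' h)@_L = lcx h by rewrite -qu' M_coef_u.
  by apply: mcoeff_cancel => //; exact/lcx_neq0/G_neq0.
have S_lt : supp_in (fun t => ltx t L) S.
  move=> t tS; have : le_ (@ltx n) L t.
    apply: (supp_inB _ _ tS); apply: supp_inZ.
      by rewrite -qu; exact: M_supp_u.
    by rewrite -qu'; exact: M_supp_u.
  case/orP => // /eqP eq_t.
  by move: tS; rewrite eq_t -mcoeff_neq0 S_coef eqxx.
have S_ordd : supp_in (fun t => (ordd t <= B0)%N) S.
  apply: supp_inB; apply: supp_inZ.
    by apply: supp_in_sub (@M_supp_ordd q g) => t /leq_trans; apply.
  by apply: supp_in_sub (@M_supp_ordd q' h) => t /leq_trans; apply.
have := xdreduces_rep ME red S_lt S_ordd; rewrite subr0 => /(rep_M r).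
rewrite rL => /(rep_sub le_b0 (fun _ lt_t => lt_t)) rep_S.
have comp_g := @M_comp r q.1 q.2 g Gg.
have comp_h := @M_comp r q'.1 q'.2 h Gh.
move: comp_g comp_h; rewrite -!surjective_pairing -def_th -def_th' qu qu' rL.
rewrite -tmul_r -tmul_r'.
move=> /(rep_sub le_g (fun _ lt_t => lt_t))/(repZ (lcx g)^-1) rep_g.
move=> /(rep_sub le_h (fun _ lt_t => lt_t))/(repZ (lcx h)^-1) rep_h.
have MS : M r S =
    (lcx g)^-1 *: M r (M q g) - (lcx h)^-1 *: M r (M q' h).
  by rewrite /S linearB; congr (_ - _); exact: linearZ.
rewrite MS in rep_S.
by have := repD (repB rep_S rep_g) rep_h; rewrite telescope_scale.
Qed.

(** Extracts the largest leading term of a representation; the empty one has none, hence the case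
    [f = 0]. That [w] satisfies [P] makes the descent strict when [P] is a strict bound. *)
Lemma rep_max B P f : rep B P f ->
  f = 0 \/ exists2 w, P w & rep B (le_ (@ltx n) w) f.
Proof.
elim=> [|c th g h Gg le_g Pu _ [->|[w Pw rep_h]]]; first by left.
  right; exists (tmul th (u_ g)) => //.
  by right; [| |exact/orP/or_introl/eqxx|left].
right; have := term_order_total (@ltx_order n) (tmul th (u_ g)) w.
case/or3P => [/eqP eq_w|lt_w|gt_w].
- by exists w => //; right => //; rewrite eq_w /le_ eqxx.
- by exists w => //; right => //; rewrite /le_ lt_w orbT.
- exists (tmul th (u_ g)) => //; right => //; first by rewrite /le_ eqxx.
  apply: rep_sub rep_h => // t /orP[/eqP ->|lt_t]; apply/orP; right => //.
  exact: lexlt_trans lt_t gt_w.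
Qed.

(** * Cancellation at the top term and descent *)

Section SPolynomials.
Hypothesis spoly : forall B w g h th th', g \in G -> h \in G ->
  tmul th (u_ g) = w -> tmul th' (u_ h) = w ->
  (ordd (tmul th (v_ g)) <= B)%N -> (ordd (tmul th' (v_ h)) <= B)%N ->
  rep B (fun t => ltx t w)
    ((lcx g)^-1 *: M th g - (lcx h)^-1 *: M th' h).

(** All summands with leading term [w] are merged into one, each merger costing an S-polynomial that
    is representable below [w]. *)
Lemma rep_collect B w f : rep B (le_ (@ltx n) w) f ->
  rep B (fun t => ltx t w) f \/
  exists g th c, [/\ g \in G, (ordd (tmul th (v_ g)) <= B)%N,
    tmul th (u_ g) = w & rep B (fun t => ltx t w) (f - c *: M th g)].
Proof.
elim=> [|c th g h Gg le_g /orP[/eqP eq_w|lt_w] _ IH]; first by left; left.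
- right; case: IH => [rep_h|[g' [th' [c' [Gg' le_g' eq_w' rep_h]]]]].
    by exists g, th, c; split; rewrite // addrC addKr.
  (* The first summand contributes [c * lcx g] at [w]; dividing by [lcx g'] turns this into a
     multiple of [M th' g']. *)
  exists g', th', (c * lcx g / lcx g' + c').
  split; [exact: Gg'|exact: le_g'|exact: eq_w'|].
  rewrite collect_scale; last exact/lcx_neq0/G_neq0.
  by apply: repD rep_h; apply: repZ; exact: spoly.
- case: IH => [rep_h|[g' [th' [c' [Gg' le_g' eq_w' rep_h]]]]].
    by left; right.
  by right; exists g', th', c'; split=> //; rewrite -addrA; right.
Qed.

(** Well-founded induction on [w] plays the part of a minimal choice. If the merged coefficient is
    0, the representation drops below [w]; otherwise [w] survives in [f] and is its leading term. *)
Lemma rep_lead B w f : f != 0 -> rep B (le_ (@ltx n) w) f ->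
  exists g th, [/\ g \in G, (ordd (tmul th (v_ g)) <= B)%N &
    tmul th (u_ g) = u_ f].
Proof.
move=> f0; elim/(well_founded_ind (term_order_wf (@ltx_order n))): w => w IH.
have case_lt : rep B (fun t => ltx t w) f -> exists g th, [/\ g \in G,
    (ordd (tmul th (v_ g)) <= B)%N & tmul th (u_ g) = u_ f].
  by case/rep_max => [f00|[w' lt_w']]; [rewrite f00 eqxx in f0 | exact: IH].
case/rep_collect => [//|[g [th [c [Gg le_g eq_w rep_f]]]]].
have [c0|c0] := eqVneq c 0.
  by apply: case_lt; move: rep_f; rewrite c0 scale0r subr0.
exists g, th; split=> //; rewrite eq_w.
have lt_f := rep_supp_lt rep_f.
have fw : w \in msupp f.
  rewrite -mcoeff_neq0 -(subrK (c *: M th g) f) mcoeffD mcoeffZ.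
  rewrite -{2}eq_w M_coef_u (mcoeff_outdom (g := _ - _)) ?add0r.
    by rewrite mulf_neq0 // lcx_neq0 // G_neq0.
  by apply/negP => /lt_f; rewrite /ltx lexlt_irr.
have le_u : le_ (@ltx n) w (u_ f).
  apply: (_ : supp_in (le_ (@ltx n) w) f); last exact: maxby_msupp.
  rewrite -(subrK (c *: M th g) f); apply: supp_inD.
    by apply: supp_in_sub lt_f => t lt_t; rewrite /le_ lt_t orbT.
  by apply: supp_inZ; rewrite -eq_w; exact: M_supp_u.
have := maxby_max (@ltx_order n) fw; rewrite -/(u_ f).
case/orP: le_u => [/eqP -> //|lt_u] /orP[/eqP //|lt_w].
by have := lexlt_trans lt_u lt_w; rewrite lexlt_irr.
Qed.

End SPolynomials.

(** Division with respect to [<_d], by well-founded induction on [v_ f]. It gives no control over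
    the terms [theta u_g], hence the trivial predicate. *)
Lemma groebner_d_rep (N : E K n -> Prop) B f :
  (forall c th h g, N h -> N g -> N (h - c *: M th g)) ->
  groebner_d N G -> N f -> (ordd (v_ f) <= B)%N -> rep B (fun=> True) f.
Proof.
move=> NB [NG div]; move eq_v: (v_ f) => v.
elim/(well_founded_ind (term_order_wf (@ltd_order n))): v f eq_v => v IH f.
move=> eq_v Nf le_b; have [->|f0] := eqVneq f 0; first by left.
have [g Gg /tquotK] := div f Nf f0.
set th := tquot _ _ => th_v.
(* This [c] cancels the [<_d]-leading term of [f]. *)
pose c := f@_(v_ f) / g@_(v_ g); pose f' := f - c *: M th g.
have -> : f = c *: M th g + f' by rewrite addrC subrK.
right=> //; first by rewrite th_v eq_v.
have Nf' : N f' by apply: NB => //; case: (NG g Gg).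
have [->|f'0] := eqVneq f' 0; first by left.
have lt_v : ltd (v_ f') v.
  have v'f' : v_ f' \in msupp f' by exact: maxby_msupp.
  have : le_ (@ltd n) (v_ f) (v_ f').
    apply: (_ : supp_in (le_ (@ltd n) (v_ f)) f') v'f'; apply: supp_inB.
      exact: (@supp_maxby _ (@ltd_order n) f).
    apply: supp_inZ; rewrite -th_v.
    exact: (@M_supp _ (@ltd_order n) th _ _ (@supp_maxby _ (@ltd_order n) g)).
  case/orP => [/eqP eq_v'|]; last by rewrite eq_v.
  move: v'f'; rewrite eq_v' -mcoeff_neq0 mcoeffB mcoeffZ -{2}th_v M_coef_v.
  rewrite /c mulfVK ?subrr ?eqxx // mcoeff_neq0.
  by apply: maxby_msupp; exact: G_neq0.
apply: (IH _ lt_v) => //; apply: leq_trans le_b.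
exact: ltd_ordd.
Qed.

End Representations.
End LeadingTerms.

(** * The concrete action on the free module, and the theorem *)

Section ConcreteAction.
Variables (K : fieldType) (n : nat).
Implicit Types (f g : E K n) (t : term n) (j : 'I_n).

Lemma lin_ext_linear (phi : term n -> E K n) : linear (lin_ext phi).
Proof.
move=> c f g; rewrite /lin_ext.
(* The three supports differ, so all sums are first extended by zeros to a common index set. *)
have expand h (d : {fset term n}) : {subset msupp h <= d} ->
    \sum_(t <- msupp h) h@_t *: phi t = \sum_(t <- d) h@_t *: phi t.
  move=> sub_hd; apply: big_fset_incl; first exact/fsubsetP.
  by move=> t _ /mcoeff_outdom ->; rewrite scale0r.
pose d := (msupp f `|` msupp g `|` msupp (c *: f + g))%fset.
rewrite !(expand _ d); try by move=> t; rewrite !inE => ->; rewrite ?orbT.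
rewrite scaler_sumr -big_split; apply: eq_bigr => t _ /=.
by rewrite mcoeffD mcoeffZ scalerDl scalerA.
Qed.

Lemma lin_ext_bas (phi : term n -> E K n) t : lin_ext phi (bas t) = phi t.
Proof.
by rewrite bas.unlock /lin_ext msuppU oner_eq0 big_seq_fset1 mcoeffUU scale1r.
Qed.

Lemma linear_eq (F G : {linear E K n -> E K n}) :
  (forall t, F (bas t) = G (bas t)) -> F =1 G.
Proof.
move=> FG f; rewrite [f]E_expand !linear_sum; apply: eq_bigr => t _.
by rewrite !linearZ FG.
Qed.

HB.instance Definition _ j := GRing.isLinear.Build K (E K n) (E K n) *:%R
  (@actX K n j) (lin_ext_linear _).
HB.instance Definition _ j := GRing.isLinear.Build K (E K n) (E K n) *:%R
  (@actD K n j) (lin_ext_linear _).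

Lemma actX_bas j t : @actX K n j (bas t) = bas (tmul (mi_unit j, mi0) t).
Proof.
by rewrite /actX lin_ext_bas /tmul /= mi_add0 mi_addC bas.unlock.
Qed.

Lemma actD_bas j t : @actD K n j (bas t) =
  bas (tmul (mi0, mi_unit j) t) +
  (tnth (tx t) j)%:R *: bas (mi_sub (tx t) (mi_unit j), td t, ti t).
Proof.
rewrite /actD lin_ext_bas /tmul /= mi_add0 [mi_add _ (td t)]mi_addC.
by rewrite bas.unlock.
Qed.

Let X j : {linear E K n -> E K n} := @actX K n j.
Let D j : {linear E K n -> E K n} := @actD K n j.

Lemma mact_linear th : linear (@mact K n th).
Proof. exact: (monom_act_linear X D). Qed.

HB.instance Definition _ th :=
  GRing.isLinear.Build K (E K n) (E K n) *:%R (@mact K n th) (mact_linear th).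

Let M th : {linear E K n -> E K n} := @mact K n th.

Lemma mact0 f : M (mi0, mi0) f = f.
Proof. exact: (monom_act0 X D). Qed.

Lemma actX_mact j a b f : X j (M (a, b) f) = M (mi_add (mi_unit j) a, b) f.
Proof. exact: (X_monom D linear_eq actX_bas). Qed.

Lemma actD_mact j a b f : D j (M (a, b) f) =
  M (a, mi_add (mi_unit j) b) f +
  (tnth a j)%:R *: M (mi_sub a (mi_unit j), b) f.
Proof. exact: (D_monom linear_eq actX_bas actD_bas). Qed.

Lemma submodule_mact m (N : E K n -> Prop) th f :
  is_submodule m N -> N f -> N (mact th f).
Proof.
move=> [_ _ _ _ [NX ND]] Nf.
have Niter (F : E K n -> E K n) k g : (forall h, N h -> N (F h)) ->
    N g -> N (iter k F g).
  by move=> NF Ng; elim: k => //= k; exact: NF.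
have Nfold (F : 'I_n -> E K n -> E K n) (a : mi n) s g :
    (forall j h, N h -> N (F j h)) -> N g ->
    N (foldr (fun j h => iter (tnth a j) (F j) h) g s).
  by move=> NF Ng; elim: s => //= k s IH; apply: Niter => // h; exact: NF.
by apply: (Nfold); [exact: NX | apply: (Nfold); [exact: ND | exact: Nf]].
Qed.

Lemma submodule_sub m (N : E K n -> Prop) c th f g :
  is_submodule m N -> N f -> N g -> N (f - c *: M th g).
Proof.
move=> subN Nf Ng; have Nth := submodule_mact th subN Ng.
case: subN => _ _ ND NZ _; rewrite -scaleN1r.
by apply: ND => //; apply: (NZ); apply: (NZ); exact: Nth.
Qed.

Lemma groebner_xd_of_spoly m (N : E K n -> Prop) (G : seq (E K n)) :
  is_submodule m N -> groebner_d N G ->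
  (forall g h, g \in G -> h \in G -> xdreduces G (Sx g h) 0) ->
  groebner_xd N G.
Proof.
move=> subN grG red; have [NG _] := grG; split=> // f Nf f0.
have G0 g : g \in G -> g != 0 by move/NG => [].
(* Here [B] is [ordd (v_ f)] itself, which the final comparison of [d] requires. *)
have rep_f := groebner_d_rep actX_bas actD_bas mact0 actX_mact actD_mact G0
  (fun c th h g => @submodule_sub m N c th h g subN) grG Nf (leqnn _).
have [f00|[w _ rep_w]] := rep_max rep_f; first by rewrite f00 eqxx in f0.
have spoly B w' g h th th' (Gg : g \in G) (Gh : h \in G) :=
  @spoly_rep K n X D M actX_bas actD_bas mact0 actX_mact actD_mact G G0
    B w' g h th th' (fun _ _ => erefl) Gg Gh (red g h Gg Gh).
have [g [th [Gg le_v eq_u]]] := rep_lead actX_bas actD_bas mact0 actX_mact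
  actD_mact G0 spoly f0 rep_w.
exists g => //; split; first by rewrite -eq_u tdivides_mul.
(* The [ord_d] of [th] enters both [th v_g] and [th u_g = u_f], so it cancels in the difference. *)
by move: le_v; rewrite /dval -eq_u !ordd_mul; lia.
Qed.

End ConcreteAction.

Theorem theorem4p11 (K : fieldType) (n m : nat) (N : E K n -> Prop) (G : seq (E K n)) :
  [pchar K] =i pred0 ->
  is_submodule m N ->
  groebner_d N G ->
  (forall gi gj, gi \in G -> gj \in G -> xdreduces G (Sx gi gj) 0) ->
  groebner_xd N G.
Proof.
by move=> _; exact: groebner_xd_of_spoly.
Qed.
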